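(* For the symmetric group $G=S_n$, the sample complexity $k_{\min}$ of discriminating the generalized hidden shift states of $G$ (with $m=|G|$) satisfies, as $n\to\infty$, $$k_{\min}\ge\Omega(\sqrt{n\log n})=\Omega(\sqrt{\log|G|}).$$
   Context: Generalized hidden shift states: for a finite group $G$ and $m=|G|$, let $\mathrm{reg}_G$ be the regular representation of $G$ on $\mathbb{C}[G]$ and, for $h\in G$, define the density operator on $\mathbb{C}^{m}\otimes\mathbb{C}[G]$ $$\tilde\rho_h=\frac{1}{m|G|}\sum_{b,c\in\mathbb{Z}/m}|b\rangle\langle c|\otimes \mathrm{reg}_G(h^{b-c}).$$ (Up to a unitary independent of $h$, this is $\frac1{|G|}\sum_{g\in G}|\phi_{g,h}\rangle\langle\phi_{g,h}|$ with $|\phi_{g,h}\rangle=\frac1{\sqrt m}\sum_{b\in\mathbb{Z}/m}|b,gh^b\rangle$.) For an ensemble $(p_i,\sigma_i)_i$ the optimal success probability is $p^*_{\mathrm{succ}}=\max\{\sum_i p_i\mathrm{tr}(M_i\sigma_i): M_i\ge0,\ \sum_iM_i=\mathbb 1\}$. Sample complexity: $k_{\min}$ is the least $k\ge1$ such that the ensemble $\{(\tfrac1{|G|},\tilde\rho_h^{\otimes k})\}_{h\in G}$ has $p^*_{\mathrm{succ}}\ge\frac23$. *)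

(* Defs.v *)
From HB Require Import structures.
From mathcomp Require Export all_boot all_order all_algebra all_fingroup.
From mathcomp Require Export mxrepresentation.
From mathcomp Require Export all_classical all_reals all_analysis.
From mathcomp Require Export complex.
From mathcomp Require mxtens.

Set Implicit Arguments.
Unset Strict Implicit.
Unset Printing Implicit Defensive.

Export Order.TTheory GRing.Theory Num.Theory.
Export numFieldNormedType.Exports.

Local Open Scope ring_scope.
Local Open Scope complex_scope.
Local Open Scope sesquilinear_scope.

Section Discrimination.
Variables (R : realType) (d : nat) (I : finType).

(* In the partial order of R[i], [0 <= z] includes that z is real, so this
   entails that A is Hermitian. *)
Definition mx_psd (A : 'M[R[i]]_d) : Prop :=
  forall v : 'cV[R[i]]_d, 0 <= (v ^t* *m A *m v) 0 0.

Definition povm (M : I -> 'M[R[i]]_d) : Prop :=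
  (forall i, mx_psd (M i)) /\ \sum_i M i = 1%:M.

(* The trace of a product of two positive semidefinite matrices is real, so
   nothing is lost by taking its real part. *)
Definition success_prob (p : I -> R) (sigma M : I -> 'M[R[i]]_d) : R :=
  \sum_i p i * complex.Re (\tr (M i *m sigma i)).

(* The set of POVMs is compact, so for an ensemble (I nonempty) this supremum
   is a maximum. *)
Definition opt_success_prob (p : I -> R) (sigma : I -> 'M[R[i]]_d) : R :=
  sup [set success_prob p sigma M | M in povm]%classic.

End Discrimination.

Section GeneralizedHiddenShift.
Variables (R : realType) (gT : finGroupType).
Local Notation G := [set: gT]%G.

(* Basis vectors of C^m (m = |G|) and of C[G] are both indexed by 'I_#|G|.
   [regular_repr] is the right regular representation; the one by left
   translations is conjugate to it by the permutation g |-> g^-1, which does not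
   depend on h.  As h ^+ m = 1, h ^+ b * h ^- c is h^(b - c) for b - c in Z/m. *)
Definition hidden_shift_state (h : gT) : 'M[R[i]]_(#|G| * #|G|) :=
  ((#|G| * #|G|)%:R)^-1 *:
    \sum_(b < #|G|) \sum_(c < #|G|)
      mxtens.tensmx (delta_mx b c : 'M[R[i]]_#|G|)
                    (regular_repr R[i] G (h ^+ b * h ^- c)%g).

Definition hidden_shift_success_prob (k : nat) : R :=
  opt_success_prob (fun _ : gT => (#|G|%:R)^-1)
                   (fun h => mxtens.ntensmx (hidden_shift_state h) k).

Definition is_sample_complexity (k : nat) : Prop :=
  let sufficient j := (1 <= j)%N /\ 2 / 3 <= hidden_shift_success_prob j in
  sufficient k /\ forall j, sufficient j -> (k <= j)%N.

End GeneralizedHiddenShift.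

(* Main.v *)
From mathcomp Require Import cyclic ring lra.
Require Import Defs.

(* The state of h is a normalised projector P_h of rank |G|.  If h has order r,
   its control register lives in the r-periodic functions on Z/m, so P_h is
   dominated by a projector Q_r of trace r|G| that depends only on r.  Since the
   elements of a POVM sum to 1, all h of the same order r <= N together
   contribute at most r^k to |G| p_succ, whence
     |G| p_succ <= #{h : ord h > N} + N^(k+1).
   In S_n the order of s is at most n^c(s), where c(s) is the number of cycles,
   and c has mean H_n <= 1 + ln n; by Markov's inequality N = n^O(ln n) exceeds
   the order of at least three quarters of S_n.  Hence n! <= 3 N^(k+1), that is
   k = Omega(n / ln n), which is more than sqrt(n ln n). *)

Set Implicit Arguments.
Unset Strict Implicit.
Unset Printing Implicit Defensive.

Local Open Scope ring_scope.

(** * Cycles and orders of permutations *)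

(** The order divides the product of the cycle lengths, each of which is at most [#|T|]. *)
Lemma order_perm_le (T : finType) (s : {perm T}) :
  (#[s]%g <= #|T| ^ #|porbits s|)%N.
Proof.
pose L := (\prod_(X in porbits s) #|X|)%N.
have L_gt0 : (0 < L)%N.
  apply: prodn_cond_gt0 => X /imsetP[x _ ->].
  by rewrite lt0n card_porbit_neq0.
have sL : (s ^+ L)%g = 1%g.
  apply/permP => x; rewrite perm1 /L (bigD1 (porbit s x)) ?imset_f //=.
  rewrite permX mulnC iterM.
  by elim: (bigop _ _ _) => //= m ->; rewrite iter_porbit.
have /dvdn_leq -/(_ L_gt0) : (#[s]%g %| L)%N by rewrite order_dvdn sL.
move/leq_trans; apply.
rewrite -prod_nat_const; apply: leq_prod => X _; exact: max_card.
Qed.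

Section MeanPorbits.
Variables (R : numFieldType) (T : finType).
Implicit Types (x y : T) (A : {set T}) (s : {perm T}).

(** A fixed point x is a cycle of its own, outside that of y, so the transposition merges the
    two. *)
Lemma porbits_mul_tperm_fix s x y : s x = x -> x != y ->
  #|porbits (tperm x y * s)%g|.+1 = #|porbits s|.
Proof.
move=> sx xy; have := porbits_mul_tperm s x y.
have -> : x \notin porbit s y.
  rewrite porbit_sym; apply/porbitP => -[m]; rewrite permX.
  have -> : iter m s x = x by elim: m => //= m ->.
  by move/esym/eqP; apply/negP.
by rewrite xy /= addn1 addn2 => -[].
Qed.

(** The product applies [tperm x y] first, so it fixes x exactly when s maps y to x. *)
Lemma perm_on_tpermM A x y s : x \notin A -> y \in x |: A ->
  perm_on A (tperm x y * s)%g =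
  perm_on (x |: A) s && ((s^-1)%g x == y).
Proof.
move=> xA yA.
have xAt : perm_on (x |: A) (tperm x y).
  have /fintype.subsetP txy := tperm_on x y; apply/fintype.subsetP => z /txy.
  by rewrite in_set2 => /orP[]/eqP-> //; exact: setU11.
apply/idP/andP => [As|[As /eqP sx]].
  split.
    rewrite -[s]mul1g -(tperm2 x y) -mulgA perm_onM //.
    by move/fintype.subsetP: As => As; apply/fintype.subsetP => z /As; rewrite in_setU1 orbC => ->.
  rewrite (canF_eq (permKV s)).
  by have := out_perm As xA; rewrite permM tpermL => ->.
have := perm_onM xAt As => /fintype.subsetP xAts; apply/fintype.subsetP => z zts.
have := xAts z zts; rewrite in_setU1 => /predU1P[zx|//].
by move: zts; rewrite inE zx permM tpermL -{1}sx permKV eqxx.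
Qed.

(** Sort the permutations by the preimage y of x; multiplying by [tperm x y] carries each class onto
    the permutations supported in A. *)
Lemma sum_perm_onU1 (F : {perm T} -> R) A x : x \notin A ->
  \sum_(s | perm_on (x |: A) s) F s =
  \sum_(y in x |: A) \sum_(s | perm_on A s) F (tperm x y * s)%g.
Proof.
move=> xA; rewrite (partition_big (fun s : {perm T} => (s^-1)%g x) (mem (x |: A))) /=.
  apply: eq_bigr => y yA.
  rewrite (reindex_inj (mulgI (tperm x y))) /=.
  apply: eq_bigl => s.
  by rewrite -perm_on_tpermM // mulgA tperm2 mul1g.
move=> s sA; have := perm_closed x (perm_onV sA).
by rewrite !inE eqxx => ->.
Qed.

(* Adding a point x to A writes each permutation uniquely as tperm x y * s with
   s supported in A; for y != x this has one cycle fewer than s, so the mean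
   drops by a / (a + 1), where a = #|A|. *)
Lemma sum_card_porbits_perm_on A :
  \sum_(s | perm_on A s) #|porbits s|%:R =
  (#|A| `!)%:R * (#|T|%:R - #|A|%:R + \sum_(i < #|A|) i.+1%:R^-1) :> R.
Proof.
have [a] := ubnP #|A|; elim: a A => // a IHa A; rewrite ltnS.
have [-> _|[x xA]] := set_0Vmem A.
  (* Only the identity is supported in the empty set; its cycles are the singletons. *)
  rewrite cards0 subr0 big_ord0 addr0 mul1r (big_pred1 1%g) => [|s].
    congr _%:R; rewrite -[RHS](card_imset predT (@set1_inj T)).
    apply: eq_card => X; apply/imsetP/imsetP => -[x _ ->]; exists x => //.
      by rewrite porbit.unlock cycle1 imset_set1 /aperm perm1.
    by rewrite porbit.unlock cycle1 imset_set1 /aperm perm1.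
  apply/idP/eqP => [s0|->]; last exact: perm_on1.
  by apply: (perm_on_id s0); rewrite cards0.
rewrite -(finset.setD1K xA); set B := (A :\ x)%SET.
have xB : x \notin B by rewrite !inE eqxx.
rewrite cardsU1 xB add1n => /IHa {}IHa.
rewrite sum_perm_onU1 // big_setU1 //= tperm1.
under eq_bigr do rewrite mul1g.
have -> : \sum_(y in B) \sum_(s | perm_on B s) #|porbits (tperm x y * s)%g|%:R
    = \sum_(y in B) \sum_(s | perm_on B s) (#|porbits s|%:R - 1) :> R.
  apply: eq_bigr => y yB; apply: eq_bigr => s Bs.
  rewrite -(@porbits_mul_tperm_fix s x y) ?(out_perm Bs) //.
    by rewrite -addn1 natrD addrK.
  by apply: contraNneq xB => ->.
rewrite sumr_const sumrB sumr_const card_perm IHa //.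
rewrite big_ord_recr /= factS.
set S := \sum_(i < _) _.
have B0 : #|B|.+1%:R != 0 :> R by rewrite pnatr_eq0.
rewrite -mulr_natl !natrM -!natr1; rewrite -natr1 in B0.
by field.
Qed.

Lemma sum_card_porbits :
  \sum_(s : {perm T}) #|porbits s|%:R = (#|T| `!)%:R * \sum_(i < #|T|) i.+1%:R^-1 :> R.
Proof.
have := sum_card_porbits_perm_on [set: T].
rewrite cardsT subrr add0r => <-; apply: eq_bigl => s.
by apply/esym/fintype.subsetP => x; rewrite !inE.
Qed.

End MeanPorbits.

Lemma harmonic_sum_le (R : realType) n : (0 < n)%N ->
  \sum_(i < n) i.+1%:R^-1 <= 1 + ln n%:R :> R.
Proof.
case: n => // n _; elim: n => [|n IHn].
  by rewrite big_ord1 invr1 ln1 addr0.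
rewrite big_ord_recr /=; apply: le_trans (lerD IHn (lexx _)) _.
rewrite -addrA lerD2l.
have n0 : 0 < n.+1%:R :> R by rewrite ltr0n.
have m0 : 0 < n.+2%:R :> R by rewrite ltr0n.
(* With u = 1/(n + 2), the inequality ln (1 - u) <= -u bounds the new term by ln (n + 2) - ln (n +
   1). *)
have -> : n.+1%:R = n.+2%:R * (1 - n.+2%:R^-1) :> R.
  by rewrite mulrBr mulr1 divff ?gt_eqF // -[n.+2%:R]natr1 addrK.
have m1 : n.+2%:R^-1 < 1 :> R by rewrite invf_lt1 // ltr1n.
rewrite lnM ?posrE ?subr_gt0 // -addrA gerDl.
have := @le_ln1Dx R (- n.+2%:R^-1); rewrite ltrN2 => /(_ m1).
by set u := ln _; set v := _^-1; lra.
Qed.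

(** Markov's inequality: K is at least four times the mean number of cycles. *)
Lemma card_many_porbits (R : realType) (T : finType) (K : nat) : (0 < #|T|)%N ->
  4 * (1 + ln #|T|%:R) <= K%:R :> R ->
  (4 * #|[set s : {perm T} | K < #|porbits s|]| <= #|T| `!)%N.
Proof.
move=> T0 HK.
have H1 : 1 <= 1 + ln #|T|%:R :> R by rewrite lerDl ln_ge0 // ler1n.
have K0 : 0 < K%:R :> R by lra.
set B := finset _.
have KB : (K * #|B|)%:R <= \sum_(s : {perm T}) #|porbits s|%:R :> R.
  rewrite -natr_sum ler_nat (bigID (mem B)) /=; apply: leq_trans (leq_addr _ _).
  rewrite mulnC -sum_nat_const; apply: leq_sum => s.
  by rewrite inE => /ltnW.
rewrite sum_card_porbits in KB.
rewrite -(ler_nat R) natrM -(ler_pM2l K0).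
have := ler_wpM2l (ler0n R #|T| `!) (harmonic_sum_le R T0).
have := ler_wpM2l (ler0n R #|T| `!) HK.
by rewrite natrM in KB; nra.
Qed.

(** * Tensor powers and orthogonal projectors *)

Section TensorPowers.
Local Open Scope sesquilinear_scope.
Variable C : numClosedFieldType.
Import mxtens.

Lemma mxtrace_tens m n (A : 'M[C]_m) (B : 'M[C]_n) :
  \tr (tensmx A B) = \tr A * \tr B.
Proof. by rewrite /mxtrace mulr_sum; apply: eq_bigr => j _; rewrite mxE. Qed.

Lemma tensmx11 m n : tensmx (1%:M : 'M[C]_m) (1%:M : 'M[C]_n) = 1%:M.
Proof.
apply/matrixP => j k; case: (mxtens_indexP j) => j1 j2.
case: (mxtens_indexP k) => k1 k2.
rewrite tensmxE !mxE -natrM mulnb; congr (nat_of_bool _)%:R.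
by rewrite (can_eq (@mxtens_indexK _ _)) xpair_eqE.
Qed.

Lemma scale_tensmxl m n p q (a : C) (A : 'M[C]_(m, n)) (B : 'M[C]_(p, q)) :
  tensmx (a *: A) B = a *: tensmx A B.
Proof. by apply/matrixP => j k; rewrite !mxE mulrA. Qed.

Lemma scale_tensmxr m n p q (a : C) (A : 'M[C]_(m, n)) (B : 'M[C]_(p, q)) :
  tensmx A (a *: B) = a *: tensmx A B.
Proof. by apply/matrixP => j k; rewrite !mxE mulrCA. Qed.

Lemma tensmx_suml m n p q (I : finType) (A : I -> 'M[C]_(m, n)) (B : 'M[C]_(p, q)) :
  tensmx (\sum_i A i) B = \sum_i tensmx (A i) B.
Proof.
apply/matrixP => j k; rewrite !(mxE, summxE) mulr_suml.
by apply: eq_bigr => l _; rewrite mxE.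
Qed.

Lemma adjmx_tens m n p q (A : 'M[C]_(m, n)) (B : 'M[C]_(p, q)) :
  (tensmx A B)^t* = tensmx (A^t*) (B^t*).
Proof. by rewrite trmx_tens map_mxT. Qed.

Lemma adjmx_mul m n p (A : 'M[C]_(m, n)) (B : 'M[C]_(n, p)) :
  (A *m B)^t* = B^t* *m A^t*.
Proof. by rewrite trmx_mul map_mxM. Qed.

Lemma adjmxK m n (A : 'M[C]_(m, n)) : (A^t*)^t* = A.
Proof. by apply/matrixP => j k; rewrite !mxE conjCK. Qed.

Lemma ntensmx_mul n (A B : 'M[C]_n) k :
  ntensmx A k *m ntensmx B k = ntensmx (A *m B) k.
Proof.
elim: k => [|[|k] IHk] //; first by rewrite mulmx1.
by rewrite !ntensmxSS tensmx_mul IHk.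
Qed.

Lemma adjmx_ntens n (A : 'M[C]_n) k : (ntensmx A k)^t* = ntensmx (A^t*) k.
Proof.
elim: k => [|[|k] IHk] //; first by rewrite trmx1 map_mx1.
by rewrite !ntensmxSS adjmx_tens IHk.
Qed.

Lemma mxtrace_ntens n (A : 'M[C]_n) k : \tr (ntensmx A k) = \tr A ^+ k.
Proof.
elim: k => [|[|k] IHk]; [exact: mxtrace1 | by rewrite expr1 |].
by rewrite !ntensmxSS mxtrace_tens IHk [RHS]exprS.
Qed.

Lemma scale_ntensmx n (a : C) (A : 'M[C]_n) k :
  ntensmx (a *: A) k = a ^+ k *: ntensmx A k.
Proof.
elim: k => [|[|k] IHk] //; first by rewrite scale1r.
by rewrite !ntensmxSS IHk scale_tensmxl scale_tensmxr scalerA [in RHS]exprS.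
Qed.

Definition orthoprojmx n (P : 'M[C]_n) := P^t* = P /\ P *m P = P.

Lemma orthoprojmx_ntens n (P : 'M[C]_n) k :
  orthoprojmx P -> orthoprojmx (ntensmx P k).
Proof. by case=> Pa PP; split; rewrite (adjmx_ntens, ntensmx_mul) ?Pa ?PP. Qed.

Lemma orthoprojmx_tens m n (P : 'M[C]_m) (Q : 'M[C]_n) :
  orthoprojmx P -> orthoprojmx Q -> orthoprojmx (tensmx P Q).
Proof.
by case=> Pa PP [Qa QQ]; split; rewrite (adjmx_tens, tensmx_mul) ?Pa ?PP ?Qa ?QQ.
Qed.

Lemma orthoprojmx1 n : orthoprojmx (1%:M : 'M[C]_n).
Proof. by split; rewrite ?mulmx1 // trmx1 map_mx1. Qed.

(** [P *m Q = P] is how domination of P by Q is expressed from here on. Its adjoint [Q *m P = P]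
    collapses the cross terms of the square. *)
Lemma orthoprojmxB n (P Q : 'M[C]_n) :
  orthoprojmx P -> orthoprojmx Q -> P *m Q = P -> orthoprojmx (Q - P).
Proof.
move=> [Pa PP] [Qa QQ] PQ.
have := congr1 (fun X : 'M[C]_n => X ^t*) PQ; rewrite /= adjmx_mul Pa Qa => QP.
split; first by rewrite linearB map_mxB; congr (_ - _).
by rewrite mulmxBl !mulmxBr QQ PQ QP PP subrr subr0.
Qed.

Lemma orthoprojmx_conj n (W P : 'M[C]_n) :
  W^t* *m W = 1%:M -> orthoprojmx P -> orthoprojmx (W *m P *m W^t*).
Proof.
move=> WW [Pa PP]; split.
  by rewrite !adjmx_mul Pa adjmxK mulmxA.
by rewrite -!mulmxA (mulmxA _ W) WW mul1mx (mulmxA P P) PP.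
Qed.

(** The projector onto the constant vectors. *)
Definition avgmx n : 'M[C]_n := const_mx n%:R^-1.

Lemma avgmx_mul n : avgmx n *m avgmx n = avgmx n.
Proof.
apply/matrixP => j k; rewrite !mxE.
rewrite (eq_bigr (fun=> n%:R^-1 * n%:R^-1)); last by move=> l _; rewrite !mxE.
rewrite sumr_const card_ord -[LHS]mulr_natl mulrA divff ?mul1r // pnatr_eq0.
by case: n j {k} => [[]|].
Qed.

Lemma orthoprojmx_avg n : orthoprojmx (avgmx n).
Proof.
split; last exact: avgmx_mul.
by apply/matrixP => j k; rewrite !mxE fmorphV rmorph_nat.
Qed.

Lemma mxtrace_avg n : (0 < n)%N -> \tr (avgmx n) = 1.
Proof.
move=> n0; rewrite /mxtrace (eq_bigr (fun=> n%:R^-1)); last by move=> l _; rewrite !mxE.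
by rewrite sumr_const card_ord -[LHS]mulr_natl divff // pnatr_eq0 -lt0n.
Qed.

(* For r dividing m, the projector onto the r-periodic vectors. *)
Definition periodicmx m r : 'M[C]_m :=
  \matrix_(b, c) ((b == c %[mod r])%:R / (m %/ r)%:R).

(** An index below qr is the pair of its quotient and remainder by r; the projector averages over
    the quotient and keeps the remainder. *)
Lemma periodicmxE q r : (0 < r)%N ->
  periodicmx (q * r) r = tensmx (avgmx q) (1%:M : 'M[C]_r).
Proof.
move=> r0; apply/matrixP => b c; rewrite !mxE mulnK // mulrC; congr (_ * _).
Qed.

Lemma orthoprojmx_periodic m r : (0 < r)%N -> (r %| m)%N ->
  orthoprojmx (periodicmx m r).
Proof.
move=> r0 /dvdnP[q ->]; rewrite periodicmxE //.
exact: orthoprojmx_tens (orthoprojmx_avg q) (orthoprojmx1 r).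
Qed.

Lemma mxtrace_periodic m r : (0 < m)%N -> (r %| m)%N ->
  \tr (periodicmx m r) = r%:R.
Proof.
move=> m0 /dvdnP[q mE]; move: m0; rewrite mE muln_gt0 => /andP[q0 r0].
by rewrite periodicmxE // mxtrace_tens mxtrace_avg // mxtrace1 mul1r.
Qed.

(** Constant vectors are r-periodic; [avgmx] factors along quotient and remainder too. *)
Lemma avgmx_periodic m r : (0 < r)%N -> (r %| m)%N ->
  avgmx m *m periodicmx m r = avgmx m.
Proof.
move=> r0 /dvdnP[q ->]; rewrite periodicmxE //.
have -> : avgmx (q * r) = tensmx (avgmx q) (avgmx r).
  by apply/matrixP => b c; rewrite !mxE natrM invfM.
by rewrite tensmx_mul avgmx_mul mulmx1.
Qed.

Definition ctrlmx m n (U : 'I_m -> 'M[C]_n) : 'M[C]_(m * n) :=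
  \sum_b tensmx (delta_mx b b) (U b).

Lemma ctrlmx_adj m n (U : 'I_m -> 'M[C]_n) :
  (ctrlmx U)^t* = ctrlmx (fun b => (U b)^t*).
Proof.
rewrite /ctrlmx linear_sum /= map_mx_sum; apply: eq_bigr => b _.
by rewrite adjmx_tens trmx_delta map_delta_mx.
Qed.

(** Serves three choices of F: the identity for unitarity, [avgmx] for the states, [periodicmx] for
    the dominating projectors. *)
Lemma ctrlmx_conj m n (U V : 'I_m -> 'M[C]_n) (F : 'M[C]_m) :
  ctrlmx U *m tensmx F 1%:M *m ctrlmx V =
  \sum_b \sum_c F b c *: tensmx (delta_mx b c) (U b *m V c).
Proof.
rewrite mulmx_suml mulmx_suml; apply: eq_bigr => b _.
rewrite mulmx_sumr; apply: eq_bigr => c _.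
rewrite !tensmx_mul mulmx1 -scale_tensmxl; congr (tensmx _ _).
(* Factoring the diagonal matrix units through dimension one isolates the scalar [F b c]. *)
have FE : delta_mx 0 b *m F *m delta_mx c 0 = (F b c)%:M :> 'M[C]_1.
  by rewrite -rowE -colE [LHS]mx11_scalar !mxE.
rewrite -[delta_mx b b](mul_delta_mx (0 : 'I_1)).
rewrite -[delta_mx c c](mul_delta_mx (0 : 'I_1)) mulmxA -(mulmxA _ _ F).
rewrite -(mulmxA (delta_mx b 0)) FE mul_mx_scalar -scalemxAl.
by rewrite mul_delta_mx.
Qed.

Lemma ctrlmx_unitary m n (U : 'I_m -> 'M[C]_n) :
  (forall b, (U b)^t* *m U b = 1%:M) -> (ctrlmx U)^t* *m ctrlmx U = 1%:M.
Proof.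
move=> UU; rewrite ctrlmx_adj -[X in X *m _]mulmx1 -tensmx11 ctrlmx_conj.
rewrite [in RHS](matrix_sum_delta (1%:M : 'M[C]_m)) tensmx_suml.
apply: eq_bigr => b _; rewrite tensmx_suml; apply: eq_bigr => c _.
rewrite scale_tensmxl mxE; case: eqP => [->|_]; last by rewrite !scale0r.
by rewrite UU.
Qed.

End TensorPowers.

(** * Discrimination of hidden shift states *)

Section PovmTraces.
Local Open Scope complex_scope.
Local Open Scope sesquilinear_scope.
Variables (R : realType) (d : nat).
Implicit Types M P Q : 'M[R[i]]_d.

(** By cyclicity this is the trace of P* M P, whose diagonal entries are the quadratic form of M at
    the columns of P. *)
Lemma mx_psd_tr_ge0 M P : mx_psd M -> orthoprojmx P -> 0 <= \tr (M *m P).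
Proof.
move=> Mpsd [Pa PP]; rewrite -PP mulmxA mxtrace_mulC mulmxA -{1}Pa.
rewrite /mxtrace sumr_ge0 // => j _.
have -> : (P^t* *m M *m P) j j = ((col j P)^t* *m M *m col j P) 0 0.
  rewrite !mxE; apply: eq_bigr => k _; rewrite !mxE; congr (_ * _).
  by apply: eq_bigr => l _; rewrite !mxE.
exact: Mpsd.
Qed.

Lemma mx_psd_tr_le M P Q : mx_psd M -> orthoprojmx P -> orthoprojmx Q ->
  P *m Q = P -> \tr (M *m P) <= \tr (M *m Q).
Proof.
move=> Mpsd oP oQ PQ; rewrite -subr_ge0 -raddfB -mulmxBr.
exact: mx_psd_tr_ge0 Mpsd (orthoprojmxB oP oQ PQ).
Qed.

Lemma sum_povm_tr (I : finType) (M : I -> 'M[R[i]]_d) Q : povm M ->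
  \sum_i \tr (M i *m Q) = \tr Q.
Proof. by case=> _ M1; rewrite -raddf_sum -mulmx_suml M1 mul1mx. Qed.

Lemma povm_tr_le (I : finType) (M : I -> 'M[R[i]]_d) Q : povm M ->
  orthoprojmx Q -> forall i, \tr (M i *m Q) <= \tr Q.
Proof.
move=> povmM oQ i; rewrite -(sum_povm_tr Q povmM) (bigD1 i) //= lerDl.
by rewrite sumr_ge0 // => j _; apply: mx_psd_tr_ge0 => //; exact: povmM.1.
Qed.

(** Indices in g of one type j share the projector [Q j], and the [M i] sum to 1, so together they
    cost a single trace of [Q j]. An index outside g costs the trace of its own projector. *)
Lemma povm_sum_tr_le (I : finType) (J : eqType) (M P : I -> 'M[R[i]]_d)
    (g : pred I) (ty : I -> J) (s : seq J) (Q : J -> 'M[R[i]]_d) :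
  povm M -> (forall i, orthoprojmx (P i)) -> uniq s ->
  (forall j, j \in s -> orthoprojmx (Q j)) ->
  (forall i, g i -> ty i \in s /\ P i *m Q (ty i) = P i) ->
  \sum_i \tr (M i *m P i) <= \sum_(i | ~~ g i) \tr (P i) + \sum_(j <- s) \tr (Q j).
Proof.
move=> povmM oP us oQ PQ; rewrite (bigID g) /= addrC.
apply: lerD; first by apply: ler_sum => i _; exact: povm_tr_le.
(* Expand each trace of [Q j] over the POVM; the surplus terms, with i outside g or j other than
   [ty i], are nonnegative. *)
rewrite big_seq; under [leRHS]eq_bigr => j _ do rewrite -(sum_povm_tr (Q j) povmM).
rewrite [leRHS]exchange_big /= [leRHS](bigID g) /= -[leLHS]addr0.
have tr_ge0 i j : j \in s -> 0 <= \tr (M i *m Q j).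
  by move=> js; apply: mx_psd_tr_ge0; [exact: povmM.1 | exact: oQ].
apply: lerD; last first.
  by rewrite sumr_ge0 // => i _; rewrite sumr_ge0 // => j /tr_ge0.
apply: ler_sum => i /PQ[tis PQi].
rewrite -big_seq (bigD1_seq (ty i)) //= -[leLHS]addr0; apply: lerD.
  by apply: mx_psd_tr_le => //; [exact: povmM.1 | exact: oQ].
by rewrite big_seq_cond sumr_ge0 // => j /andP[/tr_ge0].
Qed.

End PovmTraces.

(** * Hidden shift states as normalised projectors, and the projectors dominating them *)

Section HiddenShiftProjectors.
Local Open Scope complex_scope.
Local Open Scope sesquilinear_scope.
Variables (R : realType) (gT : finGroupType).
Local Notation G := [set: gT]%G.
Local Notation C := R[i].
Local Notation regG := (regular_repr C G).

Lemma adjmx_regular (h : gT) : (regG h)^t* = regG h^-1%g.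
Proof.
apply/matrixP => j k; rewrite !mxE eqxx /= rmorph_nat; congr (nat_of_bool _)%:R.
apply/eqP/eqP => [->|->].
  by rewrite gring_indexK ?inE // mulgK gring_valK.
by rewrite gring_indexK ?inE // mulgKV gring_valK.
Qed.

Definition ctrl_shiftmx (h : gT) := ctrlmx (fun b : 'I_#|G| => regG (h ^+ b)%g).

Lemma ctrl_shiftmx_unitary h :
  (ctrl_shiftmx h)^t* *m ctrl_shiftmx h = 1%:M.
Proof.
apply: ctrlmx_unitary => b.
by rewrite adjmx_regular -repr_mxM ?inE // mulVg repr_mx1.
Qed.

Lemma ctrl_shiftmx_conj h (F : 'M[C]_#|G|) :
  ctrl_shiftmx h *m mxtens.tensmx F 1%:M *m (ctrl_shiftmx h)^t* =
  \sum_b \sum_c F b c *: mxtens.tensmx (delta_mx b c) (regG (h ^+ b * h ^- c)%g).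
Proof.
rewrite ctrlmx_adj ctrlmx_conj.
apply: eq_bigr => b _; apply: eq_bigr => c _.
by rewrite adjmx_regular repr_mxM ?inE.
Qed.

(** Conjugating a projector that does not depend on h by a unitary yields idempotence and trace at
    once; [hidden_shift_stateE] ties it to the state. *)
Definition shift_projmx h : 'M[C]_(#|G| * #|G|) :=
  ctrl_shiftmx h *m mxtens.tensmx (avgmx _ _) 1%:M *m (ctrl_shiftmx h)^t*.

Lemma orthoprojmx_shift h : orthoprojmx (shift_projmx h).
Proof.
apply: orthoprojmx_conj; first exact: ctrl_shiftmx_unitary.
exact: orthoprojmx_tens (orthoprojmx_avg _ _) (orthoprojmx1 _ _).
Qed.

Lemma mxtrace_shift h : \tr (shift_projmx h) = #|G|%:R.
Proof.
rewrite /shift_projmx mxtrace_mulC mulmxA ctrl_shiftmx_unitary mul1mx.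
by rewrite mxtrace_tens mxtrace_avg ?cardG_gt0 // mxtrace1 mul1r.
Qed.

Lemma hidden_shift_stateE h :
  hidden_shift_state R h = #|G|%:R^-1 *: shift_projmx h.
Proof.
rewrite /shift_projmx ctrl_shiftmx_conj /hidden_shift_state natrM invfM -scalerA.
congr (_ *: _); rewrite scaler_sumr; apply: eq_bigr => b _.
by rewrite scaler_sumr; apply: eq_bigr => c _; rewrite mxE.
Qed.

Definition order_projmx r : 'M[C]_(#|G| * #|G|) :=
  mxtens.tensmx (periodicmx _ _ r) 1%:M.

Lemma orthoprojmx_order r : (0 < r)%N -> (r %| #|G|)%N ->
  orthoprojmx (order_projmx r).
Proof.
move=> r0 rG.
exact: orthoprojmx_tens (orthoprojmx_periodic _ r0 rG) (orthoprojmx1 _ _).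
Qed.

Lemma mxtrace_order r : (r %| #|G|)%N ->
  \tr (order_projmx r) = (r * #|G|)%:R.
Proof.
move=> rG; rewrite mxtrace_tens mxtrace_periodic ?cardG_gt0 //.
by rewrite mxtrace1 natrM.
Qed.

(* Entries of the periodic projector sit at b = c mod r, where h^(b-c) = 1. *)
Lemma order_projmx_conj h :
  order_projmx #[h]%g =
  ctrl_shiftmx h *m order_projmx #[h]%g *m (ctrl_shiftmx h)^t*.
Proof.
rewrite ctrl_shiftmx_conj /order_projmx [in LHS](matrix_sum_delta (periodicmx _ _ _)).
rewrite tensmx_suml; apply: eq_bigr => b _.
rewrite tensmx_suml; apply: eq_bigr => c _.
rewrite scale_tensmxl mxE.
case: eqP => [bc|_]; last by rewrite mul0r !scale0r.
suff -> : (h ^+ b * h ^- c = 1)%g by rewrite repr_mx1.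
by apply/eqP; rewrite -eq_mulgV1 eq_expg_mod_order; apply/eqP.
Qed.

(** Both factors are conjugates by the same unitary, which reduces the claim to [avgmx_periodic]. *)
Lemma shift_projmx_order h :
  shift_projmx h *m order_projmx #[h]%g = shift_projmx h.
Proof.
rewrite order_projmx_conj /shift_projmx -!mulmxA (mulmxA _ (ctrl_shiftmx h)).
rewrite ctrl_shiftmx_unitary mul1mx; congr (_ *m _).
rewrite mulmxA mxtens.tensmx_mul mulmx1 avgmx_periodic ?order_gt0 //.
by rewrite order_dvdG ?inE.
Qed.

End HiddenShiftProjectors.

(** * Upper bound on the success probability *)

Section SuccessBound.
Local Open Scope complex_scope.
Local Open Scope sesquilinear_scope.
Variable R : realType.

Lemma ler_Re (x y : R[i]) : x <= y -> complex.Re x <= complex.Re y.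
Proof. by rewrite lecE => /andP[]. Qed.

Lemma Re_natr n : complex.Re (n%:R : R[i]) = n%:R.
Proof. by rewrite -(rmorph_nat (real_complex R)). Qed.

Variable gT : finGroupType.
Local Notation G := [set: gT]%G.
Local Notation C := R[i].

(** Once the normalisation is cleared, each h of order above N costs |G|^k, and each order r <= N
    costs (r|G|)^k <= (N|G|)^k. At most N such orders occur, hence the exponent k + 1. *)
Lemma povm_hidden_shift_sum_le (N k : nat) (M : gT -> 'M[C]_((#|G| * #|G|) ^ k)) :
  povm M ->
  \sum_h \tr (M h *m mxtens.ntensmx (hidden_shift_state R h) k) <=
  (#|[set h : gT | (N < #[h]%g)%N]| + N ^ k.+1)%:R.
Proof.
move=> povmM; have G0 : 0 < #|G|%:R :> C by rewrite ltr0n cardG_gt0.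
under eq_bigr do rewrite hidden_shift_stateE scale_ntensmx linearZ /= mxtraceZ.
rewrite -mulr_sumr exprVn ler_pdivrMl ?exprn_gt0 //.
(* Every element order divides |G|, and for divisors r [order_projmx] is known to be a projector. *)
pose s := [seq r <- iota 1 N | (r %| #|G|)%N].
have sP r : r \in s -> [/\ (0 < r)%N, (r <= N)%N & (r %| #|G|)%N].
  by rewrite mem_filter mem_iota add1n ltnS => /and3P[? ? ?].
have := @povm_sum_tr_le R _ _ nat M (fun h => mxtens.ntensmx (shift_projmx R h) k)
  (fun h => (#[h]%g <= N)%N) (fun h => #[h]%g) s
  (fun r => mxtens.ntensmx (order_projmx R gT r) k) povmM.
move=> /(_ _ _ _ _)/le_trans; apply.
- by move=> h; apply/orthoprojmx_ntens/orthoprojmx_shift.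
- by rewrite filter_uniq ?iota_uniq.
- by move=> r /sP[r0 _ rG]; apply/orthoprojmx_ntens/orthoprojmx_order.
- move=> h hN; split; last by rewrite ntensmx_mul shift_projmx_order.
  by rewrite mem_filter order_dvdG ?inE //= mem_iota add1n ltnS order_gt0.
rewrite natrD mulrDr; apply: lerD.
  under eq_bigr do rewrite mxtrace_ntens mxtrace_shift.
  rewrite sumr_const mulr_natr le_eqVlt; apply/orP; left; apply/eqP.
  by congr (_ *+ _); apply: eq_card => h; rewrite !inE ltnNge.
rewrite -natrX -natrM.
have -> : \sum_(r <- s) \tr (mxtens.ntensmx (order_projmx R gT r) k)
    = (\sum_(r <- s) (r * #|G|) ^ k)%:R :> C.
  rewrite natr_sum !big_seq; apply: eq_bigr => r /sP[_ _ rG].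
  by rewrite mxtrace_ntens mxtrace_order // natrX.
rewrite ler_nat.
have /leq_trans : (\sum_(r <- s) (r * #|G|) ^ k <= \sum_(r <- s) (N * #|G|) ^ k)%N.
  rewrite !big_seq; apply: leq_sum => r /sP[_ rN _].
  by case: (k) => // k'; rewrite leq_exp2r // leq_mul2r rN orbT.
apply.
rewrite big_const_seq iter_addn_0 count_predT expnMn expnSr mulnA (mulnC (N ^ k)%N).
by rewrite leq_mul2l size_filter (leq_trans (count_size _ _)) ?size_iota ?orbT.
Qed.

Lemma hidden_shift_success_prob_le (N k : nat) :
  hidden_shift_success_prob R gT k <=
  (#|[set h : gT | (N < #[h]%g)%N]| + N ^ k.+1)%:R / #|G|%:R.
Proof.
set B := (X in _ <= X).
have B0 : 0 <= B by rewrite divr_ge0 ?ler0n.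
rewrite /hidden_shift_success_prob /opt_success_prob; set S := (X in sup X).
(* The supremum of the empty set is 0 by convention, so no POVM has to be exhibited. *)
have [->|/set0P S0] := eqVneq S classical_sets.set0; first by rewrite sup0.
apply: ge_sup => // _ [M povmM <-].
rewrite /success_prob -mulr_sumr mulrC ler_pM2r ?invr_gt0 ?ltr0n ?cardG_gt0 //.
rewrite -Re_natr.
have -> : \sum_h complex.Re (\tr (M h *m mxtens.ntensmx (hidden_shift_state R h) k))
  = complex.Re (\sum_h \tr (M h *m mxtens.ntensmx (hidden_shift_state R h) k)).
  by apply/esym/big_morph => // - [a b] [a' b'].
exact/ler_Re/povm_hidden_shift_sum_le.
Qed.

End SuccessBound.

(** * Sample complexity for the symmetric group *)

Lemma prodn_succ n : (\prod_(j < n) j.+1 = n`!)%N.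
Proof. by rewrite fact_prod -(big_mkord predT S) big_add1. Qed.

Lemma fact_le_expn n : (n`! <= n ^ n)%N.
Proof.
rewrite -prodn_succ -[X in (_ <= _ ^ X)%N]card_ord -prod_nat_const.
by apply: leq_prod => j _.
Qed.

(* Pair the factor j + 1 of n! with the factor n - j. *)
Lemma expn_le_fact_sq n : (n ^ n <= n`! ^ 2)%N.
Proof.
rewrite expnS expn1 -prodn_succ [X in (_ <= _ * X)%N](reindex_inj rev_ord_inj).
rewrite -big_split /= -[X in (_ ^ X <= _)%N]card_ord -prod_nat_const.
apply: leq_prod => j _; have := ltn_ord j; set m := nat_of_ord j => jn.
(* With X = n - m >= 1, (m + 1)X = X + mX >= X + m = n. *)
have nE : (n = (n - m.+1).+1 + m)%N by rewrite addSnnS subnK.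
by rewrite {1}nE mulSn leq_add2l leq_pmulr.
Qed.

Section LnFact.
Variable R : realType.

Lemma ln_fact_le n : ln n`!%:R <= n%:R * ln n%:R :> R.
Proof.
case: n => [|n]; first by rewrite mul0r fact0 ln1.
rewrite mulr_natl -lnXn ?ltr0n // ler_ln ?posrE ?exprn_gt0 ?ltr0n ?fact_gt0 //.
by rewrite -natrX ler_nat fact_le_expn.
Qed.

Lemma le_ln_fact n : n%:R * ln n%:R <= 2 * ln n`!%:R :> R.
Proof.
case: n => [|n]; first by rewrite mul0r fact0 ln1 mulr0.
rewrite !mulr_natl -!lnXn ?ltr0n ?fact_gt0 //.
rewrite ler_ln ?posrE ?exprn_gt0 ?ltr0n ?fact_gt0 //.
by rewrite -!natrX ler_nat expn_le_fact_sq.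
Qed.

(** Cube the inequality t <= exp t at t = ln x / 3. This is what makes n / ln n dominate sqrt(n ln
    n). *)
Lemma ln_cube_le (x : R) : 1 <= x -> ln x ^+ 3 <= 27 * x.
Proof.
move=> x1; have x0 : 0 < x by rewrite (lt_le_trans ltr01).
have L0 := ln_ge0 x1.
have xE : x = expR (ln x / 3) ^+ 3.
  by rewrite -expRM_natl mulrCA divff ?mulr1 ?lnK ?posrE // pnatr_eq0.
have H : ln x / 3 <= expR (ln x / 3).
  by apply: le_trans (expR_ge1Dx _); rewrite lerDr.
have := lerXn2r 3 _ _ H; rewrite !nnegrE divr_ge0 ?expR_ge0 // -xE.
by move=> /(_ isT isT); rewrite expr_div_n => h; lra.
Qed.

End LnFact.

Section SampleComplexity.
Variable R : realType.

(** With N = n^K at most a quarter of the permutations have order above N, so (2/3) n! <= n!/4 +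
    N^(k+1); the resulting constant 12/5 is rounded up to 3. *)
Lemma fact_le_sample_complexity n k K : (0 < n)%N ->
  is_sample_complexity R {perm 'I_n} k ->
  4 * (1 + ln n%:R) <= K%:R :> R ->
  (n`! <= 3 * n ^ (K * k.+1))%N.
Proof.
move=> n0 [[_ succ_k] _] KP.
have := le_trans succ_k (hidden_shift_success_prob_le R _ (n ^ K) k).
rewrite cardsT card_Sn ler_pdivlMr ?ltr0n ?fact_gt0 // -expnM.
set bad := (X in (X + _)%N%:R) => succ_le.
have bad_le : (4 * bad <= n`!)%N.
  have := @card_many_porbits R 'I_n K; rewrite card_ord => /(_ n0 KP).
  apply: leq_trans; rewrite leq_mul2l; apply/orP; right.
  apply: subset_leq_card; apply/fintype.subsetP => s; rewrite !inE.
  apply: contraLR; rewrite -!leqNgt => sK.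
  by apply: leq_trans (order_perm_le s) _; rewrite card_ord leq_pexp2l.
move: succ_le; rewrite natrD => succ_le.
have pow_ge0 : 0 <= (n ^ (K * k.+1))%:R :> R := ler0n _ _.
by rewrite -!(ler_nat R) !natrM in bad_le *; lra.
Qed.

Lemma sqrt_le_sample_complexity n k : (0 < n)%N -> 1 <= ln n%:R :> R ->
  is_sample_complexity R {perm 'I_n} k ->
  Num.sqrt (n%:R * ln n%:R) <= 210 * k%:R :> R.
Proof.
move=> n0 L1 kP; have k1 : 1 <= k%:R :> R by rewrite ler1n; case: kP => -[].
have n0' : 0 < n%:R :> R by rewrite ltr0n.
set L : R := ln n%:R in L1 *.
pose K := (Num.truncn (4 * (1 + L))).+1.
(* K is the least integer above 4(1 + L), hence at most 5 + 4L <= 9L. *)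
have /andP[KL KU] : K.-1%:R <= 4 * (1 + L) < K%:R by apply: truncn_itv; lra.
have fact_le : ln n`!%:R <= ln 3 + K%:R * (k%:R + 1) * L.
  rewrite natr1 -natrM mulr_natl -lnXn // -lnM ?posrE ?exprn_gt0 //.
  rewrite ler_ln ?posrE ?mulr_gt0 ?exprn_gt0 ?ltr0n ?fact_gt0 //.
  by rewrite -natrX -natrM ler_nat; exact: fact_le_sample_complexity (ltW KU).
have K9 : K%:R <= 9 * L by rewrite -[K%:R]/(K.-1.+1%:R) -natr1; lra.
have ln3 : ln 3 <= 2 :> R.
  by rewrite -[X in ln X]/(1 + 2 : R); apply: le_ln1Dx; lra.
have := le_ln_fact R n; rewrite -/L => le_fact.
(* nL <= 2 ln n! <= 4 + 2 * 18 k L^2, and 4 <= 4 k L^2. *)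
have nL : n%:R <= 40 * k%:R * L.
  have kk : K%:R * (k%:R + 1) <= 9 * L * (2 * k%:R) by apply: ler_pM; lra.
  have kL : 1 <= k%:R * L by exact: mulr_ege1.
  rewrite -(ler_pM2r (lt_le_trans ltr01 L1)).
  have := ler_wpM2r (le_trans ler01 L1) kk.
  have : 1 <= k%:R * L * L by exact: mulr_ege1.
  lra.
have k0 : 0 <= 210 * k%:R :> R by lra.
rewrite -[leRHS](ger0_norm k0) -sqrtr_sqr ler_wsqrtr //.
(* Squaring n <= 40kL gives n^2 L <= 1600 k^2 L^3 <= 43200 k^2 n, and 43200 <= 210^2. *)
have L3 : L ^+ 3 <= 27 * n%:R by apply: ln_cube_le; rewrite ler1n.
rewrite -(ler_pM2r n0').
have nn : n%:R ^+ 2 <= (40 * k%:R * L) ^+ 2 by rewrite lerXn2r ?nnegrE; lra.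
have := ler_wpM2r (le_trans ler01 L1) nn.
have := ler_wpM2l (sqr_ge0 (40 * k%:R : R)) L3.
have := mulr_ge0 (sqr_ge0 (k%:R : R)) (ltW n0').
lra.
Qed.

End SampleComplexity.

Local Open Scope classical_set_scope.

Theorem corollary12 (R : realType) (kmin : nat -> nat)
    (kminP : forall n : nat, is_sample_complexity R {perm 'I_n} (kmin n)) :
  [/\ (fun n : nat => (kmin n)%:R : R^o)
        \is 'Omega_\oo (fun n : nat => Num.sqrt (n%:R * ln n%:R) : R^o),
      (fun n : nat => (kmin n)%:R : R^o)
        \is 'Omega_\oo (fun n : nat => Num.sqrt (ln #|{perm 'I_n}|%:R) : R^o)
    & (fun n : nat => Num.sqrt (n%:R * ln n%:R) : R^o)
        \is 'Theta_\oo (fun n : nat => Num.sqrt (ln #|{perm 'I_n}|%:R) : R^o)].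
Proof.
have large : \forall n \near \oo, (0 < n)%N /\ 1 <= ln n%:R :> R.
  near=> n; have n0 : (0 < n)%N by near: n; exact: nbhs_infty_gt.
  split=> //; rewrite -[leLHS]expRK ler_ln ?posrE ?expR_gt0 ?ltr0n //.
  by near: n; exact: nbhs_infty_ger.
(* ln n! lies between (n ln n)/2 and n ln n: this gives the constants 1 and sqrt 2 of the last claim
   and reduces the second claim to the first. *)
have fact_le n : Num.sqrt (ln #|{perm 'I_n}|%:R) <= Num.sqrt (n%:R * ln n%:R) :> R.
  by rewrite ler_wsqrtr // card_Sn ln_fact_le.
have le_fact n : Num.sqrt (n%:R * ln n%:R)
    <= Num.sqrt 2 * Num.sqrt (ln #|{perm 'I_n}|%:R) :> R.
  by rewrite -sqrtrM // ler_wsqrtr // card_Sn le_ln_fact.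
have norm_sqrt (x : R) : `|Num.sqrt x : R^o| = Num.sqrt x.
  by rewrite ger0_norm ?sqrtr_ge0.
split; rewrite qualifE; apply/asboolP.
- exists 210^-1; rewrite ?invr_gt0 //; near=> n.
  have [n0 L1] : (0 < n)%N /\ 1 <= ln n%:R :> R by near: n.
  rewrite norm_sqrt normr_nat ler_pdivrMl //.
  exact: sqrt_le_sample_complexity.
- exists 210^-1; rewrite ?invr_gt0 //; near=> n.
  have [n0 L1] : (0 < n)%N /\ 1 <= ln n%:R :> R by near: n.
  rewrite norm_sqrt normr_nat ler_pdivrMl //.
  exact: le_trans (fact_le n) (sqrt_le_sample_complexity _ _ _).
- exists (1, Num.sqrt 2); first by rewrite /= ltr01 sqrtr_gt0 ltr0n.
  by near=> n; rewrite !norm_sqrt mul1r.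
Unshelve. all: by end_near.
Qed.
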